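(* Let $k$ be a field, let $R=k[x_1,\ldots,x_n]$, and let $\Delta$ be a simplicial tree (or, more generally, a simplicial forest) whose vertices are among $x_1,\ldots,x_n$. Let $I=\mathcal{F}(\Delta)\subseteq R$ be its facet ideal and let $I^{\vee}\subseteq R$ be the dual of $I$. Then $I^{\vee}$ is a componentwise linear ideal.
   Context: A simplicial complex $\Delta$ is a collection of subsets (faces) of a finite nonempty vertex set, closed under taking subsets and containing every singleton of a vertex; its facets are its maximal faces. A subcollection of $\Delta$ is a simplicial complex whose set of facets is a subset of the set of facets of $\Delta$. Vertices are identified with variables. The facet ideal $\mathcal{F}(\Delta)\subseteq R$ is the ideal generated by the square-free monomials $\prod_{x\in F}x$, where $F$ ranges over the facets of $\Delta$. $\Delta$ is connected if for any two facets $F,F'$ there is a sequence of facets starting at $F$ and ending at $F'$ in which consecutive facets have nonempty intersection. A facet $F$ of $\Delta$ is a leaf if either $F$ is the only facet of $\Delta$, or there is a facet $G\neq F$ of $\Delta$ such that $F\cap F'\subseteq G$ for every facet $F'\ne F$ of $\Delta$. $\Delta$ is a forest if every nonempty subcollection of $\Delta$ has a leaf; a tree is a connected forest. A vertex cover of $\Delta$ is a set of vertices that intersects every facet of $\Delta$; a minimal vertex cover is one minimal under inclusion. The cover complex $\Delta_M$ is the simplicial complex whose facets are the minimal vertex covers of $\Delta$. The dual of $I=\mathcal{F}(\Delta)$ is $I^{\vee}=\mathcal{F}(\Delta_M)$, i.e. the ideal of $R$ generated by the monomials $\prod_{x\in A}x$ with $A$ a minimal vertex cover of $\Delta$ (equivalently,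 the Alexander dual ideal of $I$). For a square-free monomial ideal $J\subseteq R$ and a positive integer $j$, the $j$-th square-free homogeneous component $J_{[j]}$ is the ideal generated by all square-free monomials of degree $j$ in $J$. $J$ is componentwise linear if $J_{[j]}$ has a linear resolution for all $j$. An ideal $L\subseteq R$ (standard grading $\deg x_i=1$) has a linear resolution if $R/L$ has a minimal free resolution such that for all $j>1$ the nonzero entries of the matrices of the maps $R^{\beta_j}\to R^{\beta_{j-1}}$ have degree 1 (in particular the zero ideal vacuously has a linear resolution). *)

(* Defs.v *)
From HB Require Import structures.
From mathcomp Require Import all_boot all_order all_algebra.
From mathcomp Require Import mpoly.

Set Implicit Arguments.
Unset Strict Implicit.
Unset Printing Implicit Defensive.

Import GRing.Theory.
Local Open Scope ring_scope.

Section Complexes.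
Variable T : finType.

Record simplicial_complex := SimplicialComplex {
  vertices : {set T};
  faces : {set {set T}};
  vertices_neq0 : vertices != set0;
  face_sub : forall F : {set T}, F \in faces -> F \subset vertices;
  face_closed : forall F G : {set T}, F \in faces -> G \subset F -> G \in faces;
  face_vertex : forall x, x \in vertices -> [set x] \in faces
}.

Implicit Types (D : simplicial_complex) (A B F G : {set T}).

Definition facets D : {set {set T}} :=
  [set F | maxset (fun G => G \in faces D) F].

(* The vertex set of a subcollection is in general smaller than that of D. *)
Definition subcollection (D' D : simplicial_complex) : Prop :=
  facets D' \subset facets D.

Definition connected D : Prop :=
  forall F F', F \in facets D -> F' \in facets D ->
  exists s : seq {set T},
    [/\ {subset s <= facets D},
        path (fun A B : {set T} => A :&: B != set0) F s
      & last F s = F'].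

Definition leaf D F : Prop :=
  F \in facets D /\
  (facets D = [set F] \/
   exists G, [/\ G \in facets D, G != F &
     forall F', F' \in facets D -> F' != F -> F :&: F' \subset G]).

(* Every complex here is nonempty, since its vertex set is. *)
Definition forest D : Prop :=
  forall D', subcollection D' D -> exists F, leaf D' F.

Definition tree D : Prop := connected D /\ forest D.

Definition vertex_cover D A : bool :=
  (A \subset vertices D) && [forall F in facets D, A :&: F != set0].

Definition min_vertex_cover D A : bool := minset (vertex_cover D) A.

Definition min_vertex_covers D : {set {set T}} :=
  [set A | min_vertex_cover D A].

Lemma facet_exists D x : x \in vertices D ->
  exists2 F, F \in facets D & x \in F.
Proof.
move=> xV; have [F Fmax xF] := maxset_exists (face_vertex xV).
by exists F; rewrite ?inE // -sub1set.
Qed.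

Lemma facet_neq0 D F : F \in facets D -> F != set0.
Proof.
rewrite inE => /maxsetP [_ Fmax]; apply/eqP => F0.
have /set0Pn [x xV] := vertices_neq0 D.
have := Fmax [set x] (face_vertex xV); rewrite F0 sub0set => /(_ isT) /setP /(_ x).
by rewrite !inE eqxx.
Qed.

Lemma vertex_coverT D : vertex_cover D (vertices D).
Proof.
rewrite /vertex_cover subxx; apply/forall_inP => F FD.
have FV : F \subset vertices D.
  by apply: (@face_sub D); move: FD; rewrite inE => /maxsetP [].
by rewrite (setIidPr FV) (facet_neq0 FD).
Qed.

Section CoverComplex.
Variable D : simplicial_complex.

Let cvertices : {set T} := cover (min_vertex_covers D).
Let cfaces : {set {set T}} :=
  [set A : {set T} | [exists B in min_vertex_covers D, A \subset (B : {set T})]].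

Fact cover_vertices_neq0 : cvertices != set0.
Proof.
have [B Bmin _] := minset_exists (vertex_coverT D).
have /andP [_ /forall_inP Bcov] := minsetp Bmin.
have /set0Pn [x xV] := vertices_neq0 D.
have [F FD _] := facet_exists xV.
have /set0Pn [y] := Bcov F FD; rewrite inE => /andP [yB _].
by apply/set0Pn; exists y; apply/bigcupP; exists B; rewrite ?inE.
Qed.

Fact cover_face_sub A : A \in cfaces -> A \subset cvertices.
Proof.
rewrite inE => /exists_inP [B BM AB].
by apply: subset_trans AB _; apply: (bigcup_sup B).
Qed.

Fact cover_face_closed A B : A \in cfaces -> B \subset A -> B \in cfaces.
Proof.
rewrite !inE => /exists_inP [C CM AC] BA.
by apply/exists_inP; exists C => //; apply: subset_trans AC.
Qed.

Fact cover_face_vertex x : x \in cvertices -> [set x] \in cfaces.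
Proof.
move=> /bigcupP [B BM xB]; rewrite inE.
by apply/exists_inP; exists B; rewrite ?sub1set.
Qed.

Definition cover_complex : simplicial_complex :=
  SimplicialComplex cover_vertices_neq0 cover_face_sub
    cover_face_closed cover_face_vertex.

Lemma facets_cover_complex : facets cover_complex = min_vertex_covers D.
Proof.
apply/setP => A; rewrite inE; apply/idP/idP.
  move=> /maxsetP [/=]; rewrite inE => /exists_inP [B BM AB] Amax.
  rewrite -(Amax B _ AB) // inE; apply/exists_inP; exists B => //.
move=> AM; apply/maxsetP; split=> [|B] /=.
  by rewrite inE; apply/exists_inP; exists A.
rewrite inE => /exists_inP [C CM BC] AB; apply/eqP; rewrite eqEsubset AB andbT.
move: CM; rewrite inE => /minsetP [_ Cmin].
have /minsetp Acov : min_vertex_cover D A by move: AM; rewrite inE.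
by rewrite (Cmin A Acov (subset_trans AB BC)).
Qed.

End CoverComplex.
End Complexes.

Section Ideals.
Variables (k : fieldType) (n : nat).
Local Notation R := {mpoly k[n]}.

Definition ideal_generated (S : R -> Prop) (p : R) : Prop :=
  exists (m : nat) (c g : 'I_m -> R),
    (forall i, S (g i)) /\ p = \sum_(i < m) c i * g i.

Definition sqfree_monomial (A : {set 'I_n}) : R := \prod_(i in A) 'X_i.

Definition facet_ideal (D : simplicial_complex 'I_n) : R -> Prop :=
  ideal_generated (fun p => exists2 F, F \in facets D & p = sqfree_monomial F).

(* The dual of [facet_ideal D]. *)
Definition dual_ideal (D : simplicial_complex 'I_n) : R -> Prop :=
  facet_ideal (cover_complex D).

Definition sqfree_component (J : R -> Prop) (j : nat) : R -> Prop :=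
  ideal_generated (fun p =>
    exists A : {set 'I_n}, [/\ #|A| = j, p = sqfree_monomial A & J p]).

(* A minimal graded free resolution
     ... -> R^(mfr_rank 2) -> R^(mfr_rank 1) -> R^(mfr_rank 0) -> R/L -> 0.
   Elements of the free modules are row vectors and the map
   R^(mfr_rank j.+1) -> R^(mfr_rank j) is v |-> v *m mfr_map j.
   The augmentation onto R/L sends v to the class of v *m mfr_aug, so that
   mfr_aug lists representatives of the images of the basis vectors.
   The i-th basis vector of R^(mfr_rank j) has degree mfr_deg i, and all maps
   are homogeneous of degree 0. *)
Record minimal_free_resolution (L : R -> Prop) := MinimalFreeResolution {
  mfr_rank : nat -> nat;
  mfr_deg : forall j, 'I_(mfr_rank j) -> nat;
  mfr_aug : 'cV[R]_(mfr_rank 0);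
  mfr_map : forall j, 'M[R]_(mfr_rank j.+1, mfr_rank j);
  mfr_aug_homog : forall i, mfr_aug i 0 \is (mfr_deg i).-homog;
  mfr_map_homog : forall j i l m, m \in msupp (mfr_map j i l) ->
    mfr_deg i = (mfr_deg l + mdeg m)%N;
  mfr_aug_surj : forall p : R, exists v : 'rV[R]_(mfr_rank 0),
    L (p - (v *m mfr_aug) 0 0);
  mfr_aug_exact : forall v : 'rV[R]_(mfr_rank 0),
    L ((v *m mfr_aug) 0 0) <-> exists w, v = w *m mfr_map 0;
  mfr_map_exact : forall j (v : 'rV[R]_(mfr_rank j.+1)),
    v *m mfr_map j = 0 <-> exists w, v = w *m mfr_map j.+1;
  (* every entry lies in the ideal generated by the variables *)
  mfr_minimal : forall j i l, (mfr_map j i l)@_0%MM = 0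
}.

(* [mfr_map j.+1] is the map from the free module in homological degree j + 2,
   so that the matrix of generators [mfr_map 0] of L is not constrained; the
   zero polynomial is homogeneous of every degree. *)
Definition linear_resolution (L : R -> Prop) : Prop :=
  exists P : minimal_free_resolution L,
    forall j i l, mfr_map P j.+1 i l \is 1.-homog.

Definition componentwise_linear (J : R -> Prop) : Prop :=
  forall j : nat, (0 < j)%N -> linear_resolution (sqfree_component J j).

End Ideals.

(* Main.v *)
Require Import Defs.
From mathcomp Require Import all_boot all_order all_algebra.
From mathcomp Require Import mpoly.
From Stdlib Require Import ClassicalEpsilon.

(** The square-free monomials of the dual ideal are the products over the sets
that meet every facet, so its component of degree j is the ideal L(E, W, j)
generated by the monomials of the j-subsets of W meeting every edge of E, where
E is the set of facets and W the set of all variables. The proof treats all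
E contained in the facets and all W at once, by induction on #|W|.

For a variable x in W, put E_x = {F in E | x notin F}. Sorting the generators
by whether they contain x gives L = x A + B with A = L(E_x, W - x, j - 1) and
B = L(E, W - x, j) ([cover_ideal_split]). Suppose moreover that B is contained
in A. As x does not occur in the generators of B, multiplication by x is
injective modulo B ([monomial_ideal_colon]), and therefore
0 -> B(-1) -> A(-1) + B -> L -> 0, with b |-> (b, - x b) and
(a, b) |-> x a + b, is exact. The inclusion of B, generated in degree j, in A,
generated in degree j - 1, lifts to a map of resolutions whose matrices have
linear entries ([comparison_exists]), so the mapping cone of b |-> (b, - x b)
is a linear resolution of L as soon as A and B have one ([cone_strand]).

B is contained in A if every generator of B has an element y such that all edges
through y pass through x: that y may be removed. This holds if some edge F has
a point x of W common to all the edges that meet F inside W. For a forest such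
F and x exist ([forest_centre]). Call two edges adjacent when they meet inside
W. A leaf F with its branch G satisfies N[F] <= N[G] in the adjacency graph, and
every subset of the edges has a leaf; hence the graph has no induced cycle of
length at least 4, and, as any chordal graph, it has a simplicial vertex F
([simplicial_exists]). The edges meeting F then pairwise meet inside W, and
the edges of a forest have the Helly property ([forest_helly]), which gives x. *)

Set Implicit Arguments.
Unset Strict Implicit.
Unset Printing Implicit Defensive.

(** * Simplicial vertices in hereditarily dominated graphs *)

Section DominatedGraphs.
Variables (T : finType) (e : rel T).
Hypotheses (e_refl : reflexive e) (e_sym : ssrbool.symmetric e).
Implicit Types (U P C : {set T}).

Definition edges_in U : rel T := [rel a b | [&& a \in U, b \in U & e a b]].

Lemma connect_invariant (r : rel T) (Inv : T -> Prop) a b :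
  (forall x y, r x y -> Inv x -> Inv y) -> Inv a -> connect r a b -> Inv b.
Proof.
move=> step Ia /connectP [p]; elim: p a Ia => [|c p IH] a Ia /=; first by move=> _ ->.
by case/andP=> ac cp; apply: IH cp; apply: step ac Ia.
Qed.

(** Closed neighbourhoods: N[F] <= N[G] in the graph induced on U, except that an
isolated F is dominated by any other vertex. *)
Definition dominated_in U F G : Prop :=
  [/\ F \in U, G \in U, G != F &
    forall F', F' \in U -> F' != F -> e F F' -> e F G /\ e G F'].

Variable V : {set T}.
Hypothesis dominatedV : forall U, U \subset V -> 1 < #|U| ->
  exists F G, dominated_in U F G.

(** Chordality, in the form used below: two nonadjacent neighbours b1, b2 of s
joined by a walk avoiding the neighbours of s would close up to a chordless
cycle. When P is minimal, the vertices s, b1, b2 and P induce that cycle, in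
which no vertex is dominated by another one. Instead of exhibiting the cycle,
take F dominated by G: if F is s, b1 or b2, adjacency is read off directly, and
if F is in P, moving F to G sends the walk to a walk that avoids F. *)
Lemma common_neighbours_adjacent s b1 b2 P :
  s \in V -> b1 \in V -> b2 \in V -> P \subset V -> e s b1 -> e s b2 ->
  {in P, forall p, ~~ e s p} ->
  connect (edges_in (b1 |: (b2 |: P))) b1 b2 -> e b1 b2.
Proof.
move=> sV b1V b2V; have [m] := ubnP #|P|; elim: m P => // m IH P Pm PV sb1 sb2 sP.
set Q := b1 |: (b2 |: P) => con; apply/negPn/negP => b12.
have sNb1 : s != b1 by apply: contraNneq b12 => <-.
have sNb2 : s != b2 by apply: contraNneq b12 => <-; rewrite e_sym.
have UV : s |: Q \subset V by rewrite !subUset !sub1set sV b1V b2V.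
have Ucard : 1 < #|s |: Q|.
  have <- : #|[set s; b1]| = 2 by rewrite cards2 sNb1.
  by apply: subset_leq_card; apply: setUS; rewrite sub1set !inE eqxx.
have [F [G [FU GU GF dom]]] := dominatedV UV Ucard.
have b1U : b1 \in s |: Q by rewrite !inE eqxx !orbT.
have b2U : b2 \in s |: Q by rewrite !inE eqxx !orbT.
have sU : s \in s |: Q by rewrite !inE eqxx.
have PU p : p \in P -> p \in s |: Q by rewrite !inE => ->; rewrite !orbT.
have PNs p : p \in P -> p != s.
  by move=> pP; apply: contraNneq (sP p pP) => ->.
have PNb1 p : p \in P -> p != b1.
  by move=> pP; apply: contraNneq (sP p pP) => ->.
have PNb2 p : p \in P -> p != b2.
  by move=> pP; apply: contraNneq (sP p pP) => ->.
have Fs : F != s.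
  apply/eqP => Fs; rewrite Fs in FU GF dom.
  have [|sG Gb1] := dom b1 b1U _ sb1; first by rewrite eq_sym.
  have [|_ Gb2] := dom b2 b2U _ sb2; first by rewrite eq_sym.
  move: GU; rewrite !inE (negPf GF) /= => /or3P [/eqP GE|/eqP GE|GP].
  - by rewrite GE (negPf b12) in Gb2.
  - by rewrite GE e_sym (negPf b12) in Gb1.
  - by move: (sP G GP); rewrite sG.
have Fb1 : F != b1.
  apply/eqP => Fb1; rewrite Fb1 in FU GF dom.
  have [|b1G Gs] := dom s sU sNb1; first by rewrite e_sym.
  have Es : G = s.
    move: GU; rewrite !inE (negPf GF) /= => /or3P [/eqP //|/eqP GE|GP].
      by rewrite GE (negPf b12) in b1G.
    by move: (sP G GP); rewrite e_sym Gs.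
  (* All neighbours of b1 are neighbours of s, so the walk cannot leave b1. *)
  suff : b2 = b1 by move=> b21; rewrite b21 e_refl in b12.
  apply: (connect_invariant (Inv := fun c => c = b1) _ _ con) => // x y /=.
  case/and3P=> _; rewrite !inE => /or3P [/eqP //|/eqP ->|yP] + xE; rewrite xE.
    by rewrite (negPf b12).
  move=> b1y; have [|_] := dom y (PU y yP) _ b1y; first exact: PNb1.
  by rewrite Es (negPf (sP y yP)).
have Fb2 : F != b2.
  apply/eqP => Fb2; rewrite Fb2 in FU GF dom.
  have [|b2G Gs] := dom s sU sNb2; first by rewrite e_sym.
  have Es : G = s.
    move: GU; rewrite !inE (negPf GF) /= => /orP [/eqP //|/orP [/eqP GE|GP]].
      by rewrite GE e_sym (negPf b12) in b2G.
    by move: (sP G GP); rewrite e_sym Gs.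
  (* Symmetrically, the walk cannot reach b2. *)
  suff : b2 != b2 by rewrite eqxx.
  apply: (connect_invariant (Inv := fun c => c != b2) _ _ con) => [x y /=|].
    case/and3P; rewrite !inE => xQ _ + xb2.
    move: xQ; rewrite (negPf xb2) /= => xQ xy; apply/eqP => yE.
    rewrite yE in xy; case/orP: xQ => [/eqP xE|xP].
      by rewrite xE (negPf b12) in xy.
    have [|_] := dom x (PU x xP) xb2; first by rewrite e_sym.
    by rewrite Es (negPf (sP x xP)).
  by apply: contraNneq b12 => <-; apply: e_refl.
have FP : F \in P by move: FU; rewrite !inE (negPf Fs) (negPf Fb1) (negPf Fb2).
have QNF x : x \in Q -> x != F -> x \in b1 |: (b2 |: P :\ F).
  by rewrite !inE => xQ ->.
have QU x : x \in Q -> x \in s |: Q by move=> xQ; rewrite !inE in xQ *; rewrite xQ orbT.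
case/negP: b12; apply: (IH (P :\ F)) => //.
- by rewrite -ltnS; apply: leq_trans Pm; rewrite ltnS [in X in _ < X](cardsD1 F) FP.
- by apply: subset_trans PV; apply: subsetDl.
- by move=> p; rewrite !inE => /andP [_]; apply: sP.
have [FG|FG] := boolP (e F G); last first.
  (* F is isolated, so the walk does not visit it. *)
  have isoF x : x \in Q -> e F x -> x = F.
    move=> xQ Fx; apply/eqP/negPn/negP => xF.
    by have [FG' _] := dom x (QU x xQ) xF Fx; rewrite FG' in FG.
  suff [] : connect (edges_in (b1 |: (b2 |: P :\ F))) b1 b2 /\ b2 != F by [].
  apply: (connect_invariant (Inv := fun c =>
     connect (edges_in (b1 |: (b2 |: P :\ F))) b1 c /\ c != F) _ _ con).
    move=> x y /= /and3P [xQ yQ xy] [cx xF].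
    have yF : y != F.
      apply: contraNneq xF => yF; apply/eqP; apply: isoF => //.
      by rewrite -yF e_sym.
    split=> //; apply: connect_trans cx (connect1 _).
    by rewrite /edges_in /= !QNF.
  by split; [apply: connect0|rewrite eq_sym].
have GQ : G \in Q.
  move: GU; rewrite [in X in X -> _]inE => /orP [|//]; rewrite inE => /eqP Gs.
  by move: (sP F FP); rewrite e_sym -Gs FG.
(* Moving F to the vertex that dominates it preserves adjacency up to equality,
   hence maps walks to walks. *)
pose r x := if x == F then G else x.
have rQ x : x \in Q -> r x \in b1 |: (b2 |: P :\ F).
  by rewrite /r; case: eqP => [_ _|/eqP xF xQ]; apply: QNF.
have re x y : x \in Q -> y \in Q -> e x y -> e (r x) (r y).
  rewrite /r; case: eqP => [->|/eqP xF] xQ; case: eqP => [->|/eqP yF] yQ //.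
    by move=> Fy; have [] := dom y (QU y yQ) yF Fy.
  by rewrite e_sym => Fx; rewrite e_sym; have [] := dom x (QU x xQ) xF Fx.
have rb2 : r b2 = b2 by rewrite /r eq_sym (negPf Fb2).
suff : connect (edges_in (b1 |: (b2 |: P :\ F))) b1 (r b2) by rewrite rb2.
apply: (connect_invariant (Inv := fun c =>
     connect (edges_in (b1 |: (b2 |: P :\ F))) b1 (r c)) _ _ con).
  move=> x y /= /and3P [xQ yQ xy] cx; apply: connect_trans cx (connect1 _).
  by rewrite /edges_in /= !rQ //= re.
by rewrite /r eq_sym (negPf Fb1).
Qed.

Lemma edges_in_mono U P a b : U \subset P ->
  connect (edges_in U) a b -> connect (edges_in P) a b.
Proof.
move=> UP; apply: connect_sub => x y /and3P [xU yU xy]; apply: connect1.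
by rewrite /edges_in /= !(subsetP UP).
Qed.

Definition simplicial_in U s : Prop :=
  forall a b, a \in U -> b \in U -> e s a -> e s b -> e a b.

(** Let C be a maximal connected set that does not dominate U, and D the set of
vertices not adjacent to C. By maximality every vertex that is in neither is
adjacent to all of D. A simplicial vertex s of D stays simplicial in U: two
neighbours of s outside D are joined through C, which contains no neighbour
of s, so they are adjacent by [common_neighbours_adjacent]. *)
Lemma simplicial_exists U : U \subset V -> U != set0 ->
  exists2 s, s \in U & simplicial_in U s.
Proof.
have [m] := ubnP #|U|; elim: m U => // m IH U Um UV U0.
have [clique|] := boolP [forall a in U, forall b in U, e a b].
  have /set0Pn [s sU] := U0; exists s => // a b aU bU _ _.
  by move/forall_inP: clique => /(_ a aU) /forall_inP; apply.
rewrite negb_forall_in => /exists_inP [c cU].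
rewrite negb_forall_in => /exists_inP [d dU cd].
pose far C := [&& C \subset U,
   [forall a in C, forall b in C, connect (edges_in C) a b]
   & [exists d in U, [forall a in C, ~~ e a d]]].
have far_c : far [set c].
  apply/and3P; split; first by rewrite sub1set.
    by apply/forall_inP => a /set1P ->; apply/forall_inP => b /set1P ->.
  by apply/exists_inP; exists d => //; apply/forall_inP => a /set1P ->.
have [C /maxsetP [/and3P [CU /forall_inP Ccon /exists_inP [d' d'U d'C]] Cmax] cC]
  := maxset_exists far_c.
rewrite sub1set in cC.
have conC a b : a \in C -> b \in C -> connect (edges_in C) a b.
  by move=> aC bC; move/forall_inP: (Ccon a aC); apply.
pose D := [set d in U | [forall a in C, ~~ e a d]].
have DP x : x \in D -> x \in U /\ {in C, forall a, ~~ e a x}.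
  by rewrite inE => /andP [xU /forall_inP xC].
have DU : D \subset U by apply/subsetP => x /DP [].
have cND : c \notin D by apply/negP => /DP [_ /(_ c cC)]; rewrite e_refl.
have [s sD simp] : exists2 s, s \in D & simplicial_in D s.
  apply: IH; last by apply/set0Pn; exists d'; rewrite inE d'U.
    rewrite -ltnS; apply: leq_trans Um; rewrite ltnS; apply: proper_card.
    by apply/properP; split=> //; exists c.
  exact: subset_trans UV.
have [sU sC] := DP s sD.
have nearC y : y \in U -> y \notin D -> exists2 a, a \in C & e a y.
  move=> yU; rewrite inE yU /= negb_forall_in => /exists_inP [a aC].
  by rewrite negbK; exists a.
have boundary y : y \in U -> y \notin D -> y \notin C -> {in D, forall x, e y x}.
  move=> yU yD yC x xD; apply/negPn/negP => yx.
  case/negP: yC; rewrite -(Cmax (y |: C)); [exact: setU11| |exact: subsetUr].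
  have [a aC ay] := nearC y yU yD; have [xU xC] := DP x xD.
  apply/and3P; split.
  - by rewrite subUset sub1set yU.
  - have to_a b : b \in y |: C -> connect (edges_in (y |: C)) b a /\
                                  connect (edges_in (y |: C)) a b.
      rewrite in_setU1 => /orP [/eqP ->|bC]; last first.
        by split; apply: (edges_in_mono (subsetUr _ _)); apply: conC.
      by split; apply: connect1;
         rewrite /edges_in /= setU11 [a \in _]setU1r // ?ay // e_sym ay.
    apply/forall_inP => b1 /to_a [b1a _]; apply/forall_inP => b2 /to_a [_ ab2].
    exact: connect_trans ab2.
  - apply/exists_inP; exists x => //; apply/forall_inP => b.
    by rewrite in_setU1 => /orP [/eqP -> //|]; apply: xC.
exists s => // a b aU bU sa sb.
have notC y : e s y -> y \notin C.
  by move=> sy; apply/negP => yC; move: (sC y yC); rewrite e_sym sy.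
have [aD|aD] := boolP (a \in D); have [bD|bD] := boolP (b \in D).
- exact: simp.
- by rewrite e_sym; apply: boundary => //; apply: notC.
- by apply: boundary => //; apply: notC.
have [ca caC caa] := nearC a aU aD; have [cb cbC cbb] := nearC b bU bD.
apply: (@common_neighbours_adjacent s a b C) => //; try exact: (subsetP UV).
- exact: subset_trans UV.
- by move=> p pC; rewrite e_sym; apply: sC.
have sub : C \subset a |: (b |: C) by rewrite setUA subsetUr.
apply: (@connect_trans _ _ ca).
  by apply: connect1; rewrite /edges_in /= setU11 (subsetP sub) // e_sym.
apply: (connect_trans (edges_in_mono sub (conC _ _ caC cbC))).
by apply: connect1; rewrite /edges_in /= (subsetP sub) // !inE eqxx orbT.
Qed.

End DominatedGraphs.

(** * Forests as hypergraphs *)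

Section ForestHypergraphs.
Variable T : finType.
Implicit Types (S : {set {set T}}) (A B F G W : {set T}).

(** Leaves of a bare set of edges; unlike the facets of a complex, it may be
empty, and passing to a subset needs no reconstruction. *)
Definition leaf_of S F : Prop :=
  F \in S /\
  (S = [set F] \/ exists G, [/\ G \in S, G != F &
     forall F', F' \in S -> F' != F -> F :&: F' \subset G]).

Definition forest_of S : Prop :=
  forall S', S' \subset S -> S' != set0 -> exists F, leaf_of S' F.

(** Take a leaf F with branch G. Without G, the edges have a common point x by
induction; if an edge F' other than F and G remains, x lies in F :&: F', hence
in G. *)
Lemma forest_helly S W : forest_of S -> S != set0 ->
  {in S &, forall F F', F :&: F' :&: W != set0} ->
  exists2 x, x \in W & {in S, forall F, x \in F}.
Proof.
have [m] := ubnP #|S|; elim: m S => // m IH S Sm forS S0 meet.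
have [F [FS [SF|[G [GS GF branch]]]]] := forS S (subxx _) S0.
  have /set0Pn [x] := meet F F FS FS; rewrite setIid inE => /andP [xF xW].
  by exists x => // F'; rewrite SF => /set1P ->.
have FSG : F \in S :\ G by rewrite !inE eq_sym GF.
have SGS : S :\ G \subset S by apply: subsetDl.
have [||||x xW xS] := IH (S :\ G).
- by rewrite -ltnS; apply: leq_trans Sm; rewrite ltnS [in X in _ < X](cardsD1 G) GS.
- by move=> S' /subset_trans /(_ SGS); apply: forS.
- by apply/set0Pn; exists F.
- by move=> F1 F2 /(subsetP SGS) F1S /(subsetP SGS); apply: meet.
have [/existsP [F' /andP [F'SG F'F]]|only]
  := boolP [exists F', (F' \in S :\ G) && (F' != F)].
  exists x => // F0 F0S; have [->|F0G] := eqVneq F0 G; last by apply: xS; rewrite !inE F0G.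
  apply: (subsetP (branch F' _ F'F)); first by move: F'SG; rewrite inE => /andP [].
  by rewrite inE !xS.
have /set0Pn [y] := meet F G FS GS; rewrite !inE => /andP [/andP [yF yG] yW].
exists y => // F0 F0S; have [->//|F0G] := eqVneq F0 G.
move/existsPn: only => /(_ F0); rewrite !inE F0G F0S /= negbK => /eqP ->.
exact: yF.
Qed.

Lemma forest_sub S S' : forest_of S -> S' \subset S -> forest_of S'.
Proof. by move=> forS S'S S2 /subset_trans /(_ S'S); apply: forS. Qed.

(** The point x is at the same time in W, in F and in every edge that meets F
inside W: F is a simplicial vertex of the graph of edges meeting in W, and x is
a Helly point of its neighbours. *)
Lemma forest_centre S W : forest_of S -> S != set0 ->
  {in S, forall F, F :&: W != set0} ->
  exists F x, [/\ F \in S, x \in W &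
    forall F', F' \in S -> F :&: F' :&: W != set0 -> x \in F'].
Proof.
move=> forS S0 traceN0.
pose e := [rel F F' : {set T} | (F == F') || (F :&: F' :&: W != set0)].
have e_refl : reflexive e by move=> F /=; rewrite eqxx.
have e_sym : ssrbool.symmetric e by move=> F F' /=; rewrite eq_sym [F :&: F']setIC.
have dominatedS (U : {set {set T}}) : U \subset S -> 1 < #|U| ->
    exists F G, dominated_in e U F G.
  move=> US U1; have U0 : U != set0 by rewrite -card_gt0; apply: leq_trans U1.
  have [F [FU [UF|[G [GU GF branch]]]]] := forS U US U0.
    by rewrite UF cards1 in U1.
  exists F, G; split=> // F' F'U F'F; rewrite /e /= eq_sym (negPf F'F) /=.
  case/set0Pn => y; rewrite !inE => /andP [/andP [yF yF'] yW].
  have yG : y \in G by apply: (subsetP (branch F' F'U F'F)); rewrite inE yF.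
  by split; apply/orP; right; apply/set0Pn; exists y; rewrite !inE ?yF ?yG ?yF'.
have [F FS simp] := simplicial_exists e_refl e_sym dominatedS (subxx _) S0.
pose N := [set F' in S | F :&: F' :&: W != set0].
have NS : N \subset S by apply/subsetP => F'; rewrite inE => /andP [].
have FN : F \in N by rewrite inE FS setIid traceN0.
have [||x xW xN] := @forest_helly N W (forest_sub forS NS).
- by apply/set0Pn; exists F.
- move=> F1 F2; rewrite !inE => /andP [F1S m1] /andP [F2S m2].
  have : e F1 F2 by apply: simp => //=; rewrite ?m1 ?m2 orbT.
  by rewrite /= => /orP [/eqP ->|//]; rewrite setIid traceN0.
by exists F, x; split=> // F' F'S meet; apply: xN; rewrite inE F'S.
Qed.

(** The hypothesis on forests speaks of complexes, so each set of facets has to be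
realized as the facet set of one. *)
Section Subcollections.
Variables (D : simplicial_complex T) (S : {set {set T}}).
Hypotheses (SD : S \subset facets D) (S0 : S != set0).

Let sfaces : {set {set T}} := [set A : {set T} | [exists F in S, A \subset (F : {set T})]].

Fact sub_vertices_neq0 : cover S != set0.
Proof.
have /set0Pn [F FS] := S0; have /set0Pn [x xF] := facet_neq0 (subsetP SD F FS).
by apply/set0Pn; exists x; apply/bigcupP; exists F.
Qed.

Fact sub_face_sub A : A \in sfaces -> A \subset cover S.
Proof.
by rewrite inE => /exists_inP [F FS AF]; apply: subset_trans AF _; apply: bigcup_sup.
Qed.

Fact sub_face_closed A B : A \in sfaces -> B \subset A -> B \in sfaces.
Proof.
rewrite !inE => /exists_inP [F FS AF] BA.
by apply/exists_inP; exists F => //; apply: subset_trans AF.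
Qed.

Fact sub_face_vertex x : x \in cover S -> [set x] \in sfaces.
Proof.
by move=> /bigcupP [F FS xF]; rewrite inE; apply/exists_inP; exists F; rewrite ?sub1set.
Qed.

Definition generated_complex : simplicial_complex T :=
  SimplicialComplex sub_vertices_neq0 sub_face_sub sub_face_closed sub_face_vertex.

Lemma facets_generated_complex : facets generated_complex = S.
Proof.
have SP F : F \in S -> F \in sfaces by move=> FS; rewrite inE; apply/exists_inP; exists F.
apply/setP => F; rewrite inE; apply/idP/idP.
  case/maxsetP => /=; rewrite inE => /exists_inP [G GS FG] Fmax.
  by rewrite -(Fmax G (SP G GS) FG).
move=> FS; apply/maxsetP; split=> [|B]; first exact: SP.
rewrite /= inE => /exists_inP [G GS BG] FB; apply/eqP; rewrite eqEsubset FB andbT.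
have := subsetP SD F FS; rewrite inE => /maxsetP [_ Fmax].
suff GF : G = F by rewrite -GF.
apply: Fmax; last exact: subset_trans FB BG.
by have := subsetP SD G GS; rewrite inE => /maxsetP [].
Qed.

End Subcollections.

Lemma forest_facets (D : simplicial_complex T) : forest D -> forest_of (facets D).
Proof.
move=> forD S SD S0; have [|F] := forD (generated_complex SD S0).
  by rewrite /subcollection facets_generated_complex.
by rewrite /leaf facets_generated_complex => leafF; exists F.
Qed.

End ForestHypergraphs.

Import GRing.Theory.
Local Open Scope ring_scope.

(** * Linear resolutions and mapping cones *)

Section LinearResolutions.
Variables (k : fieldType) (n : nat).
Local Notation R := {mpoly k[n]}.

Definition homog_mx d a b (M : 'M[R]_(a, b)) : Prop :=
  forall i j, M i j \is d.-homog.

Lemma homog_mx0 d a b : homog_mx d (0 : 'M[R]_(a, b)).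
Proof. by move=> i j; rewrite mxE rpred0. Qed.

Lemma homog_mxN d a b (M : 'M[R]_(a, b)) : homog_mx d M -> homog_mx d (- M).
Proof. by move=> hM i j; rewrite mxE rpredN. Qed.

Lemma homog_scalar d a (x : R) : x \is d.-homog -> homog_mx d (x%:M : 'M_a).
Proof. by move=> hx i j; rewrite mxE; apply: rpredMn. Qed.

Lemma homog_row_mx d a b c (M : 'M[R]_(a, b)) (N : 'M_(a, c)) :
  homog_mx d M -> homog_mx d N -> homog_mx d (row_mx M N).
Proof. by move=> hM hN i j; rewrite mxE; case: split => l. Qed.

Lemma homog_col_mx d a b c (M : 'M[R]_(a, b)) (N : 'M_(c, b)) :
  homog_mx d M -> homog_mx d N -> homog_mx d (col_mx M N).
Proof. by move=> hM hN i j; rewrite mxE; case: split => l. Qed.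

Lemma pihomog_mulr d e (p q : R) : q \is e.-homog ->
  pihomog mdeg (d + e) (p * q) = pihomog mdeg d p * q.
Proof.
move=> hq; elim/mpolyind: p => [|c m p _ _ IH].
  by rewrite mul0r !linear0 mul0r.
rewrite mulrDl !linearD /= IH mulrDl -scalerAl !linearZ /= -scalerAl; congr (_ *: _ + _).
have hm : ('X_[m] : R) \is (mdeg m).-homog by rewrite dhomogX.
have hmq := dhomogM hm hq.
have [<-|md] := eqVneq (mdeg m) d; first by rewrite !pihomog_dE.
rewrite (pihomog_ne0 _ hmq) ?eqn_add2r // (pihomog_ne0 _ hm) // mul0r //.
Qed.

(** Any lift along a homogeneous map of degree d may be replaced by its component of
degree 1. *)
Lemma linear_lift d a b c (M : 'M[R]_(a, b)) (N : 'M_(c, b)) :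
  homog_mx d.+1 M -> homog_mx d N ->
  (forall i, exists w : 'rV_c, row i M = w *m N) ->
  exists f : 'M_(a, c), homog_mx 1 f /\ f *m N = M.
Proof.
move=> hM hN /fin_all_exists [w Mw].
exists (\matrix_(i, j) pihomog mdeg 1 (w i 0 j)); split=> [i j|].
  by rewrite mxE; apply: pihomogP.
apply/matrixP => i j; rewrite mxE -[RHS](pihomog_dE (hM i j)).
have -> : M i j = \sum_l w i 0 l * N l j.
  by have /rowP /(_ j) := Mw i; rewrite !mxE.
rewrite linear_sum; apply: eq_bigr => l _.
by rewrite mxE; apply/esym/(pihomog_mulr 1 _ (hN l j)).
Qed.

(** A linear resolution of the ideal I itself, not of its quotient, with generators
of degree d. Leaving out the free module that covers the quotient ring makes
all matrices but the generators linear, allows d = 0 and lets the zero ideal be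
resolved by zero modules, which the induction needs. *)
Record linear_strand (d : nat) (I : R -> Prop) := LinearStrand {
  rk : nat -> nat;
  gens : 'cV[R]_(rk 0);
  dif : forall i, 'M[R]_(rk i.+1, rk i);
  gens_homog : homog_mx d gens;
  dif_homog : forall i, homog_mx 1 (dif i);
  gens_span : forall p, I p <-> exists v : 'rV_(rk 0), (v *m gens) 0 0 = p;
  gens_exact : forall v : 'rV_(rk 0), v *m gens = 0 <-> exists w, v = w *m dif 0;
  dif_exact : forall i (v : 'rV_(rk i.+1)),
    v *m dif i = 0 <-> exists w, v = w *m dif i.+1
}.

Lemma mul_rows_eq0 a b c (M : 'M[R]_(a, b)) (N : 'M_(b, c)) :
  (forall w : 'rV_a, w *m M *m N = 0) -> M *m N = 0.
Proof. by move=> h; apply/row_matrixP => i; rewrite row0 rowE mulmxA. Qed.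

Lemma dif_gens d I (P : linear_strand d I) : dif P 0 *m gens P = 0.
Proof. by apply: mul_rows_eq0 => w; apply/gens_exact; exists w. Qed.

Lemma dif_dif d I (P : linear_strand d I) i : dif P i.+1 *m dif P i = 0.
Proof. by apply: mul_rows_eq0 => w; apply/dif_exact; exists w. Qed.

Lemma zero_strand d (I : R -> Prop) : (forall p, I p <-> p = 0) -> linear_strand d I.
Proof.
move=> I0; apply: (@LinearStrand d I (fun=> 0%N) 0 (fun=> 0)).
- exact: homog_mx0.
- by move=> i; apply: homog_mx0.
- move=> p; rewrite I0; split=> [->|[v <-]]; last by rewrite mulmx0 mxE.
  by exists 0; rewrite mulmx0 mxE.
- by move=> v; split=> _; [exists 0; apply/rowP => -[]|rewrite mulmx0].
- by move=> i v; split=> _; [exists 0; apply/rowP => -[]|rewrite mulmx0].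
Qed.

Lemma unit_strand (I : R -> Prop) : (forall p, I p) -> linear_strand 0 I.
Proof.
move=> I1; pose r i := if i is 0%N then 1%N else 0%N.
apply: (@LinearStrand 0 I r 1%:M (fun=> 0)).
- by apply: homog_scalar; apply: dhomog1.
- by move=> i; apply: homog_mx0.
- by move=> p; split=> // _; exists p%:M; rewrite mulmx1 mxE.
- move=> v; split=> [|[w ->]]; last by rewrite mulmx1 mulmx0.
  by rewrite mulmx1 => ->; exists 0; rewrite mulmx0.
- by move=> i v; split=> _; [exists 0; apply/rowP => -[]|rewrite mulmx0].
Qed.

Section Comparison.
Variables (d : nat) (IA IB : R -> Prop).
Variables (A : linear_strand d IA) (B : linear_strand d.+1 IB).
Hypothesis BA : forall p, IB p -> IA p.

(** The hypothesis that boundaries of B go to boundaries of A makes the inductive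
step the same in all degrees: exactness of A provides it from the generators at
the bottom and from the previous differential above. *)
Lemma comparison_step i (f : 'M_(rk B i, rk A i)) : homog_mx 1 f ->
  (forall w : 'rV_(rk B i.+1), exists u, w *m dif B i *m f = u *m dif A i) ->
  exists g : 'M_(rk B i.+1, rk A i.+1), homog_mx 1 g /\ g *m dif A i = dif B i *m f.
Proof.
move=> hf ker; apply: (@linear_lift 1) => [a b|a b|j]; last 2 first.
- exact: dif_homog.
- by have [u] := ker (delta_mx 0 j); exists u; rewrite rowE mulmxA.
by rewrite mxE; apply: rpred_sum => l _; apply: (@dhomogM _ _ _ 1 _ 1) => //; apply: dif_homog.
Qed.

(** The comparison map is built degree by degree, with linear entries at each
stage because B is generated one degree higher than A. *)
Lemma comparison_exists : exists f : forall i, 'M_(rk B i, rk A i),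
  [/\ forall i, homog_mx 1 (f i), f 0%N *m gens A = gens B &
      forall i, f i.+1 *m dif A i = dif B i *m f i].
Proof.
have [f0 [hf0 f0g]] : exists f : 'M_(rk B 0, rk A 0),
    homog_mx 1 f /\ f *m gens A = gens B.
  apply: (@linear_lift d); [exact: gens_homog|exact: gens_homog|move=> i].
  have : IA (gens B i 0).
    apply: BA; apply/(gens_span B); exists (delta_mx 0 i).
    by rewrite -rowE mxE.
  case/(gens_span A) => v vE; exists v; apply/rowP => j.
  by rewrite (ord1 j) vE mxE.
pose good i (f : 'M_(rk B i, rk A i)) g :=
  homog_mx 1 g /\ g *m dif A i = dif B i *m f.
(* Each lift depends on the previous one, so the sequence is obtained by
   dependent choice. *)
pose F := nat_rect (fun i => 'M_(rk B i, rk A i)) f0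
  (fun i f => epsilon (inhabits 0) (good i f)).
have hF i : homog_mx 1 (F i) /\
    forall w : 'rV_(rk B i.+1), exists u, w *m dif B i *m F i = u *m dif A i.
  elim: i => [|i [hFi kerFi]].
    split=> // w; apply/gens_exact.
    by rewrite -!mulmxA f0g dif_gens mulmx0.
  have [hg gE] : good i (F i) (F i.+1) by apply: epsilon_spec; apply: comparison_step.
  split=> // w; apply/dif_exact.
  by rewrite -!mulmxA gE [dif B _ *m _]mulmxA dif_dif mul0mx mulmx0.
exists F; split=> // i; first by have [] := hF i.
have [hFi kerFi] := hF i.
by have [_] : good i (F i) (F i.+1) by apply: epsilon_spec; apply: comparison_step.
Qed.

End Comparison.

Section Cone.
Variables (d : nat) (IA IB IL : R -> Prop) (x : R).
Variables (A : linear_strand d IA) (B : linear_strand d.+1 IB).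
Hypotheses (x_homog : x \is 1.-homog) (x_neq0 : x != 0).
(* Multiplication by x is injective modulo IB. *)
Hypothesis B_colon : forall p, IB (x * p) -> IB p.
Hypothesis LE : forall p, IL p <-> exists a b, [/\ IA a, IB b & p = x * a + b].

Variable f : forall i, 'M[R]_(rk B i, rk A i).
Hypotheses (f_homog : forall i, homog_mx 1 (f i)) (f_gens : f 0%N *m gens A = gens B).
Hypothesis f_dif : forall i, f i.+1 *m dif A i = dif B i *m f i.

(** The resolution of B moved up by one homological degree; together with A and B
it makes up the cone of b |-> (b, - x b). *)
Definition shift_rk i := if i is i'.+1 then rk B i' else 0%N.

Definition shift_dif i : 'M[R]_(shift_rk i.+1, shift_rk i) :=
  if i is i'.+1 then dif B i' else 0.

Definition cone_rk i := (rk A i + (rk B i + shift_rk i))%N.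

Definition cone_gens : 'cV[R]_(cone_rk 0) :=
  col_mx (x *: gens A) (col_mx (gens B) 0).

Definition cone_dif i : 'M[R]_(cone_rk i.+1, cone_rk i) :=
  col_mx (row_mx (dif A i) 0)
    (col_mx (row_mx 0 (row_mx (dif B i) 0))
            (row_mx (f i) (row_mx (- x%:M) (- shift_dif i)))).

Lemma cone_row i (v : 'rV[R]_(cone_rk i)) : exists a b c, v = row_mx a (row_mx b c).
Proof. by exists (lsubmx v), (lsubmx (rsubmx v)), (rsubmx (rsubmx v)); rewrite !hsubmxK. Qed.

Lemma mul_cone_gens (a : 'rV_(rk A 0)) (b : 'rV_(rk B 0)) (c : 'rV_(shift_rk 0)) :
  row_mx a (row_mx b c) *m cone_gens = x *: (a *m gens A) + b *m gens B.
Proof. by rewrite !mul_row_col mulmx0 addr0 scalemxAr. Qed.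

Lemma mul_cone_dif i (a : 'rV_(rk A i.+1)) (b : 'rV_(rk B i.+1)) (c : 'rV_(rk B i)) :
  row_mx a (row_mx b c) *m cone_dif i =
  row_mx (a *m dif A i + c *m f i)
    (row_mx (b *m dif B i - x *: c) (- (c *m shift_dif i))).
Proof.
by rewrite !mul_row_col !mul_mx_row !mulmx0 !add_row_mx !add0r !mulmxN mul_mx_scalar.
Qed.

Lemma scale_eq0 a b (M : 'M[R]_(a, b)) : x *: M = 0 -> M = 0.
Proof.
move=> /matrixP xM; apply/matrixP => i j; have := xM i j.
by rewrite !mxE => /eqP; rewrite mulf_eq0 (negPf x_neq0) => /eqP.
Qed.

Lemma cone_gens_span p :
  IL p <-> exists v : 'rV_(cone_rk 0), (v *m cone_gens) 0 0 = p.
Proof.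
rewrite LE; split=> [[a [b [/(gens_span A) [v <-] /(gens_span B) [w <-] ->]]]|[v <-]].
  by exists (row_mx v (row_mx w 0)); rewrite mul_cone_gens !mxE.
have [a [b [c ->]]] := cone_row v; exists ((a *m gens A) 0 0), ((b *m gens B) 0 0).
split; [by apply/(gens_span A); exists a|by apply/(gens_span B); exists b|].
by rewrite mul_cone_gens !mxE.
Qed.

(** A relation x a + b = 0 between values in A and B has b divisible by x, and the
quotient - a is again in B: this is where [B_colon] enters. *)
Lemma cone_gens_exact (v : 'rV_(cone_rk 0)) :
  v *m cone_gens = 0 <-> exists w, v = w *m cone_dif 0.
Proof.
split=> [|[w ->]]; last first.
  have [a [b [c ->]]] := cone_row w; rewrite mul_cone_dif mul_cone_gens.
  rewrite mulmxDl mulmxBl -!mulmxA !dif_gens f_gens !mulmx0 !add0r -scalemxAl.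
  exact: subrr.
have [a [b [c ->]]] := cone_row v; rewrite mul_cone_gens => /eqP.
rewrite addr_eq0 => /eqP xa.
have : IB (x * - (a *m gens A) 0 0).
  apply/(gens_span B); exists b; move/matrixP/(_ 0 0): xa.
  by rewrite !mxE mulrN => ->; rewrite opprK.
case/B_colon/(gens_span B) => c' c'E.
have {}c'E : c' *m gens B = - (a *m gens A).
  by apply/matrixP => i j; rewrite !ord1 c'E [RHS]mxE.
have /gens_exact [a' a'E] : (a + c' *m f 0%N) *m gens A = 0.
  by rewrite mulmxDl -mulmxA f_gens c'E subrr.
have /gens_exact [b' b'E] : (b - x *: c') *m gens B = 0.
  by rewrite mulmxBl -scalemxAl c'E scalerN opprK addrC xa addNr.
exists (row_mx a' (row_mx b' (- c'))); rewrite mul_cone_dif -a'E -b'E.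
rewrite mulNmx addrK scalerN opprK subrK.
by congr (row_mx _ (row_mx _ _)); rewrite !thinmx0.
Qed.

(** If (a, b, c) is a cycle then x c is a boundary of B, so c is a cycle, hence the
boundary of some c'. Adding the image of c' removes c and leaves a cycle of A
and one of B. *)
Lemma cone_dif_exact i (v : 'rV_(cone_rk i.+1)) :
  v *m cone_dif i = 0 <-> exists w, v = w *m cone_dif i.+1.
Proof.
split=> [|[w ->]]; last first.
  have [a [b [c ->]]] := cone_row w; rewrite mul_cone_dif mul_cone_dif.
  have cE : c *m shift_dif i.+1 *m shift_dif i = 0.
    by case: i {v w a b} c => [|i] c /=; rewrite ?mulmx0 // -mulmxA dif_dif mulmx0.
  rewrite !mulNmx cE !mulmxDl !mulNmx -!mulmxA !dif_dif f_dif -scalemxAl.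
  rewrite !mulmx0 add0r sub0r scalerN !opprK -!row_mx0.
  by congr (row_mx _ (row_mx _ _)); [apply: subrr|apply: addNr].
have [a [b [c ->]]] := cone_row v; rewrite mul_cone_dif -!row_mx0.
case/eq_row_mx => ac /eq_row_mx [/eqP]; rewrite subr_eq0 => /eqP bc _.
have [c' cE] : exists c', c = c' *m dif B i.
  case: i {v} a b c ac bc => [|i] a b c _ bc; [apply/gens_exact|apply/dif_exact];
    apply: scale_eq0.
    by rewrite scalemxAl -bc -mulmxA dif_gens mulmx0.
  by rewrite scalemxAl -bc -mulmxA dif_dif mulmx0.
have /dif_exact [a' a'E] : (a + c' *m f i.+1) *m dif A i = 0.
  by rewrite mulmxDl -mulmxA f_dif mulmxA -cE.
have /dif_exact [b' b'E] : (b - x *: c') *m dif B i = 0.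
  by rewrite mulmxBl -scalemxAl -cE bc subrr.
exists (row_mx a' (row_mx b' (- c'))); rewrite mul_cone_dif -a'E -b'E.
by rewrite !mulNmx addrK scalerN !opprK subrK /= -cE.
Qed.

Lemma cone_strand : linear_strand d.+1 IL.
Proof.
apply: (@LinearStrand d.+1 IL cone_rk cone_gens cone_dif).
- apply: homog_col_mx; first by move=> i j; rewrite mxE; apply: (dhomogM x_homog (gens_homog i j)).
  by apply: homog_col_mx; [apply: gens_homog|apply: homog_mx0].
- move=> i; apply: homog_col_mx; last apply: homog_col_mx.
  + by apply: homog_row_mx; [apply: dif_homog|apply: homog_mx0].
  + by apply: homog_row_mx; [|apply: homog_row_mx];
      [apply: homog_mx0|apply: dif_homog|apply: homog_mx0].
  + apply: homog_row_mx; [|apply: homog_row_mx]; first exact: f_homog.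
      by apply: homog_mxN; apply: homog_scalar.
    apply: homog_mxN; case: i => [|i]; [exact: homog_mx0|exact: dif_homog].
- exact: cone_gens_span.
- exact: cone_gens_exact.
- exact: cone_dif_exact.
Qed.

End Cone.

(** Prepending the ring itself, in degree 0, turns a resolution of the ideal into one
of the quotient; d > 0 makes the matrix of generators minimal. *)
Lemma linear_resolution_strand d (I L : R -> Prop) : (0 < d)%N ->
  (forall p, L p <-> I p) -> linear_strand d I -> linear_resolution L.
Proof.
move=> d0 LI P; pose r i := if i is i'.+1 then rk P i' else 1%N.
pose M i : 'M[R]_(r i.+1, r i) := if i is i'.+1 then dif P i' else gens P.
pose D i (_ : 'I_(r i)) := if i is i'.+1 then (d + i')%N else 0%N.
have MD i : homog_mx (if i is 0%N then d else 1%N) (M i).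
  by case: i => [|i]; [apply: gens_homog|apply: dif_homog].
have L11 (v : 'rV[R]_1) : L ((v *m (1%:M : 'M_1)) 0 0) <-> exists w, v = w *m gens P.
  rewrite mulmx1 LI (gens_span P); split=> [[w wE]|[w ->]]; exists w => //.
  by apply/matrixP => i j; rewrite !ord1.
unshelve eexists.
  apply: (@MinimalFreeResolution _ _ L r D 1%:M M).
  - by move=> i; rewrite !ord1 mxE; apply: dhomog1.
  - move=> [|i] a b m mM; have /dhomogP /(_ m mM) -> := MD _ a b; rewrite /D /=.
      by rewrite addn0.
    by rewrite addn1 addnS.
  - move=> p; exists p%:M; rewrite mulmx1 mxE subrr LI (gens_span P).
    by exists 0; rewrite mul0mx mxE.
  - exact: L11.
  - case=> [|i] v; [exact: gens_exact|exact: dif_exact].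
  - move=> i a b; apply: (dhomog_nemf_coeff (MD i a b)).
    by rewrite mf0; case: i {a b} => //; rewrite eq_sym -lt0n.
by move=> i; apply: dif_homog.
Qed.

End LinearResolutions.

(** * Ideals of covers *)

Section CoverIdeals.
Variables (k : fieldType) (n : nat).
Local Notation R := {mpoly k[n]}.
Implicit Types (S : R -> Prop) (p q : R) (A B F W Y : {set 'I_n}) (E : {set {set 'I_n}}).

Lemma ideal_gen_mem S p : S p -> ideal_generated S p.
Proof.
move=> Sp; exists 1%N, (fun=> 1), (fun=> p); split=> //.
by rewrite big_ord1 mul1r.
Qed.

Lemma ideal_gen0 S : ideal_generated S 0.
Proof.
by exists 0%N, (fun=> 0), (fun=> 0); split=> [[]|] //; rewrite big_ord0.
Qed.

Lemma ideal_genD S p q :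
  ideal_generated S p -> ideal_generated S q -> ideal_generated S (p + q).
Proof.
move=> [m [c [g [gS ->]]]] [m' [c' [g' [gS' ->]]]].
exists (m + m')%N, (fun i => match split i with inl a => c a | inr b => c' b end),
  (fun i => match split i with inl a => g a | inr b => g' b end).
split=> [i|]; first by case: split.
rewrite big_split_ord /=; congr (_ + _); apply: eq_bigr => i _.
  by rewrite (unsplitK (inl i)).
by rewrite (unsplitK (inr i)).
Qed.

Lemma ideal_genM S q p : ideal_generated S p -> ideal_generated S (q * p).
Proof.
move=> [m [c [g [gS ->]]]]; exists m, (fun i => q * c i), g; split=> //.
by rewrite mulr_sumr; apply: eq_bigr => i _; rewrite mulrA.
Qed.

Lemma ideal_gen_least S (J : R -> Prop) : (forall p, S p -> J p) -> J 0 ->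
  (forall p q, J p -> J q -> J (p + q)) -> (forall q p, J p -> J (q * p)) ->
  forall p, ideal_generated S p -> J p.
Proof.
move=> SJ J0 JD JM p [m [c [g [gS ->]]]].
by elim/big_ind: _ => // i _; apply: JM; apply: SJ.
Qed.

Lemma ideal_gen_sub S S' : (forall p, S p -> ideal_generated S' p) ->
  forall p, ideal_generated S p -> ideal_generated S' p.
Proof.
move=> SS'; apply: ideal_gen_least => //; first exact: ideal_gen0.
  exact: ideal_genD.
exact: ideal_genM.
Qed.

Local Notation mon := (sqfree_monomial k).

Lemma sqfree_monomialD1 x Y : x \in Y -> mon Y = 'X_x * mon (Y :\ x).
Proof. by move=> xY; rewrite /sqfree_monomial (big_setD1 x). Qed.

Lemma sqfree_monomial_sub A B : A \subset B -> mon B = mon (B :\: A) * mon A.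
Proof.
move=> AB; rewrite /sqfree_monomial (big_setID A) /= mulrC.
by rewrite (setIidPr AB).
Qed.

Section Specialization.
Variable x : 'I_n.

Definition kill_var : R -> R :=
  comp_mpoly [tuple (if i == x then 0 else 'X_i : R) | i < n].

Lemma kill_varX i : kill_var 'X_i = if i == x then 0 else 'X_i.
Proof. by rewrite /kill_var comp_mpolyXU -tnth_nth tnth_mktuple. Qed.

Lemma kill_varM p q : kill_var (p * q) = kill_var p * kill_var q.
Proof. exact: rmorphM. Qed.

Lemma kill_varD p q : kill_var (p + q) = kill_var p + kill_var q.
Proof. exact: rmorphD. Qed.

Lemma kill_var_diff p : exists q, p - kill_var p = 'X_x * q.
Proof.
have mulK p1 p2 : (exists q, p1 - kill_var p1 = 'X_x * q) ->
    (exists q, p2 - kill_var p2 = 'X_x * q) ->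
    exists q, p1 * p2 - kill_var (p1 * p2) = 'X_x * q.
  move=> [q1 E1] [q2 E2]; exists (q1 * p2 + kill_var p1 * q2).
  rewrite kill_varM mulrDr mulrA -E1 mulrCA -E2 mulrBl mulrBr addrA subrK //.
elim/mpolyind: p => [|c m p _ _ [q Eq]].
  by exists 0; rewrite /kill_var rmorph0 subrr mulr0.
suff [q' Eq'] : exists q, 'X_[m] - kill_var 'X_[m] = 'X_x * q.
  exists (c *: q' + q); rewrite mulrDr -Eq -scalerAr -Eq' kill_varD.
  by rewrite /kill_var comp_mpolyZ opprD addrACA scalerBr.
rewrite mpolyXE_id; elim/big_ind: _ => [|p1 p2|i _].
- by exists 0; rewrite /kill_var rmorph1 subrr mulr0.
- exact: mulK.
elim: (m i) => [|e IH]; first by exists 0; rewrite expr0 /kill_var rmorph1 subrr mulr0.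
rewrite exprS; apply: mulK => //; rewrite kill_varX.
by case: eqP => [->|_]; [exists 1|exists 0]; rewrite ?subr0 ?mulr1 ?subrr ?mulr0.
Qed.

Lemma kill_var_monomial Y : x \notin Y -> kill_var (mon Y) = mon Y.
Proof.
move=> xY; rewrite /kill_var rmorph_prod; apply: eq_bigr => i iY.
by rewrite [LHS]kill_varX; case: eqP => // ix; rewrite -ix iY in xY.
Qed.

(** Setting x to 0 maps I into itself, since it fixes the generators, and changes an
element of I by x times an element of I. It kills x p, so x p = x q with q in
I. *)
Lemma monomial_ideal_colon S :
  (forall p, S p -> exists2 Y : {set 'I_n}, x \notin Y & p = mon Y) ->
  forall p, ideal_generated S ('X_x * p) -> ideal_generated S p.
Proof.
move=> SE p Ip; pose I := ideal_generated S.
pose J p := I (kill_var p) /\ exists2 q, I q & p - kill_var p = 'X_x * q.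
have [_ [q Iq]] : J ('X_x * p).
  apply: (ideal_gen_least _ _ _ _ Ip) => [p1 Sp1||p1 p2 [I1 [q1 Iq1 E1]] [I2 [q2 Iq2 E2]]|c p1].
  - have [Y xY p1E] := SE p1 Sp1; rewrite /J p1E kill_var_monomial // -p1E subrr.
    split; first exact: ideal_gen_mem.
    by exists 0; rewrite ?mulr0 //; apply: ideal_gen0.
  - rewrite /J /kill_var rmorph0 subrr; split; first exact: ideal_gen0.
    by exists 0; rewrite ?mulr0 //; apply: ideal_gen0.
  - rewrite /J kill_varD; split; first exact: ideal_genD.
    exists (q1 + q2); first exact: ideal_genD.
    by rewrite mulrDr -E1 -E2 opprD addrACA.
  - case=> I1 [q1 Iq1 E1]; have [c' Ec] := kill_var_diff c.
    rewrite /J kill_varM; split; first exact: ideal_genM.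
    exists (c * q1 + c' * kill_var p1); first by apply: ideal_genD; apply: ideal_genM.
    by rewrite mulrDr mulrCA -E1 mulrA -Ec mulrBl mulrBr addrA subrK.
rewrite kill_varM kill_varX eqxx mul0r subr0 => /mulfI -> //.
by rewrite -msupp_eq0 msuppX.
Qed.

End Specialization.

Definition covers_of_size E W j : {set {set 'I_n}} :=
  [set Y : {set 'I_n} | [&& Y \subset W, #|Y| == j & [forall F in E, F :&: Y != set0]]].

Definition cover_ideal E W j : R -> Prop :=
  ideal_generated (fun p => exists2 Y, Y \in covers_of_size E W j & p = mon Y).

Lemma covers_of_sizeP E W j Y : reflect
  [/\ Y \subset W, #|Y| = j & {in E, forall F, exists2 y, y \in F & y \in Y}]
  (Y \in covers_of_size E W j).
Proof.
rewrite inE; apply: (iffP and3P) => -[YW Yj cov]; split=> //.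
- exact/eqP.
- move=> F FE; move/forall_inP: cov => /(_ F FE) /set0Pn [y].
  by rewrite inE => /andP [yF yY]; exists y.
- exact/eqP.
- apply/forall_inP => F FE; have [y yF yY] := cov F FE.
  by apply/set0Pn; exists y; rewrite inE yF.
Qed.

Lemma cover_ideal_mem E W j Y : Y \in covers_of_size E W j -> cover_ideal E W j (mon Y).
Proof. by move=> YC; apply: ideal_gen_mem; exists Y. Qed.

Definition link_edges E x := [set F in E | x \notin F].

Lemma cover_ideal_split E W j x p : x \in W ->
  cover_ideal E W j.+1 p <->
  exists a b, [/\ cover_ideal (link_edges E x) (W :\ x) j a,
                  cover_ideal E (W :\ x) j.+1 b & p = 'X_x * a + b].
Proof.
move=> xW; split.
  move: p; apply: ideal_gen_least => [p [Y /covers_of_sizeP [YW Yj cov] ->]||p q|c p].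
  - have [xY|xY] := boolP (x \in Y).
      exists (mon (Y :\ x)), 0; split; [|exact: ideal_gen0|]; last first.
        by rewrite addr0 -sqfree_monomialD1.
      apply: cover_ideal_mem; apply/covers_of_sizeP; split; first exact: setSD.
        by move: Yj; rewrite (cardsD1 x) xY => -[].
      move=> F; rewrite inE => /andP [FE xF]; have [y yF yY] := cov F FE.
      by exists y => //; rewrite !inE yY andbT; apply: contraNneq xF => <-.
    exists 0, (mon Y); split; [exact: ideal_gen0| |by rewrite mulr0 add0r].
    by apply: cover_ideal_mem; apply/covers_of_sizeP; split=> //; rewrite subsetD1 YW.
  - by exists 0, 0; split; [exact: ideal_gen0..|rewrite mulr0 addr0].
  - move=> [a [b [aI bI ->]]] [a' [b' [aI' bI' ->]]].
    exists (a + a'), (b + b'); split; [exact: ideal_genD..|].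
    by rewrite mulrDr addrACA.
  - move=> [a [b [aI bI ->]]]; exists (c * a), (c * b); split; [exact: ideal_genM..|].
    by rewrite mulrDr mulrCA.
move=> [a [b [aI bI ->]]]; apply: ideal_genD.
  move: a aI; apply: ideal_gen_least => [q [Z /covers_of_sizeP [ZW Zj cov] ->]||p1 p2|c p1].
  - have xZ : x \notin Z by have := subsetP ZW x; rewrite !inE eqxx => /contra; apply.
    have -> : 'X_x * mon Z = mon (x |: Z).
      by rewrite (@sqfree_monomialD1 x (x |: Z)) ?setU11 // setU1K.
    apply: cover_ideal_mem; apply/covers_of_sizeP; split.
    + by rewrite subUset sub1set xW (subset_trans ZW) ?subsetDl.
    + by rewrite cardsU1 xZ Zj.
    + move=> F FE; have [xF|xF] := boolP (x \in F); first by exists x => //; apply: setU11.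
      by have [|y yF yZ] := cov F; [rewrite inE FE|exists y => //; apply: setU1r].
  - by rewrite mulr0; apply: ideal_gen0.
  - by rewrite mulrDr; apply: ideal_genD.
  - by rewrite mulrCA; apply: ideal_genM.
apply: ideal_gen_sub bI => q [Y /covers_of_sizeP [YW Yj cov] ->].
apply: cover_ideal_mem; apply/covers_of_sizeP; split=> //.
exact: subset_trans YW (subsetDl _ _).
Qed.

(** In the induction on #|W| the degenerate cases come first: if there is no
generator the ideal is zero, and if j = 0 and there is one the ideal is the whole
ring. In the remaining case a generator is nonempty and shows that all edges
have a point in W. *)
Lemma cover_ideal_strand E0 E W j : forest_of E0 -> E \subset E0 ->
  inhabited (linear_strand j (cover_ideal E W j)).
Proof.
move=> forE; have [m] := ubnP #|W|; elim: m W E j => // m IH W E j Wm EE0.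
have [C0|/set0Pn [Y0 Y0C]] := eqVneq (covers_of_size E W j) set0.
  constructor; apply: zero_strand => p; split=> [|->]; last exact: ideal_gen0.
  move: p; apply: ideal_gen_least => [p [Y]||p q -> ->|c p ->]; rewrite ?addr0 ?mulr0 //.
  by rewrite C0 inE.
have [Y0W Y0j Y0cov] := covers_of_sizeP _ _ _ _ Y0C.
case: j => [|j] in Y0C Y0j *.
  constructor; apply: unit_strand => p; rewrite -[p]mulr1; apply: ideal_genM.
  have <- : mon Y0 = 1; last exact: cover_ideal_mem.
  by move/eqP: Y0j; rewrite cards_eq0 => /eqP ->; rewrite /sqfree_monomial big_set0.
(* Without edges every x in W will do; otherwise x is a common point of the edges
   meeting some F in W, and any point of the cover in F may be removed. *)
have [x xW swap] : exists2 x, x \in W & forall Y, Y \in covers_of_size E (W :\ x) j.+1 ->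
    exists2 y, y \in Y & {in E, forall F, y \in F -> x \in F}.
  have [E_0|En0] := eqVneq E set0.
    have /card_gt0P [x xY0] : (0 < #|Y0|)%N by rewrite Y0j.
    exists x; first exact: (subsetP Y0W).
    move=> Y /covers_of_sizeP [_ Yj _].
    have /card_gt0P [y yY] : (0 < #|Y|)%N by rewrite Yj.
    by exists y => // F; rewrite E_0 inE.
  have [|F [x [FE xW xF]]] := @forest_centre _ E W (forest_sub forE EE0) En0.
    move=> F FE; have [y yF yY] := Y0cov F FE.
    by apply/set0Pn; exists y; rewrite inE yF (subsetP Y0W).
  exists x => // Y /covers_of_sizeP [YW _ cov]; have [y yF yY] := cov F FE.
  exists y => // F' F'E yF'; apply: xF => //; apply/set0Pn; exists y.
  by rewrite !inE yF yF'; have := subsetP YW y yY; rewrite inE => /andP [].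
have WD : (#|W :\ x| < m)%N.
  by rewrite -ltnS (leq_trans _ Wm) // ltnS [in X in (_ < X)%N](cardsD1 x) xW.
have [|A] := IH (W :\ x) (link_edges E x) j WD.
  by apply: subset_trans EE0; apply/subsetP => F; rewrite inE => /andP [].
have [B] := IH (W :\ x) E j.+1 WD EE0.
have BA p : cover_ideal E (W :\ x) j.+1 p -> cover_ideal (link_edges E x) (W :\ x) j p.
  apply: ideal_gen_sub => {p} p [Y YC ->]; have [y yY yx] := swap Y YC.
  have [YW Yj cov] := covers_of_sizeP _ _ _ _ YC.
  rewrite (sqfree_monomialD1 yY); apply: ideal_genM; apply: cover_ideal_mem.
  apply/covers_of_sizeP; split.
  - exact: subset_trans (subsetDl _ _) YW.
  - by move: Yj; rewrite (cardsD1 y) yY => -[].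
  - move=> F; rewrite inE => /andP [FE xF]; have [z zF zY] := cov F FE.
    exists z => //; rewrite !inE zY andbT; apply: contraNneq xF => zy.
    by apply: yx; rewrite -?zy.
have [f [fh fg fd]] := comparison_exists A B BA.
constructor; apply: (@cone_strand _ _ _ _ _ _ 'X_x A B _ _ _ _ f) => //.
- by rewrite dhomogX; apply/eqP/mdeg1.
- by rewrite -msupp_eq0 msuppX.
- apply: monomial_ideal_colon => p [Y /covers_of_sizeP [YW _ _] ->]; exists Y => //.
  by have := subsetP YW x; rewrite !inE eqxx => /contra; apply.
- by move=> p; apply: cover_ideal_split.
Qed.

(** Evaluating at the indicator point of A singles out the generators whose support
lies in A: if the monomial of A is in the ideal, one of them must not vanish. *)
Lemma dual_ideal_monomial (D : simplicial_complex 'I_n) A :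
  dual_ideal D (mon A) <-> {in facets D, forall F, exists2 y, y \in F & y \in A}.
Proof.
split=> [[m [c [g [gS Ag]]]] F FD|cov]; last first.
  have cover_AV : vertex_cover D (A :&: vertices D).
    rewrite /vertex_cover subsetIr; apply/forall_inP => F FD.
    have [y yF yA] := cov F FD; apply/set0Pn; exists y; rewrite !inE yA yF andbT.
    by move: FD; rewrite inE => /maxsetP [/face_sub /subsetP ->].
  have [B Bmin BA] := minset_exists cover_AV.
  have {}BA : B \subset A by apply: subset_trans BA (subsetIl _ _).
  rewrite (sqfree_monomial_sub BA); apply: ideal_genM; apply: ideal_gen_mem.
  by exists B => //; rewrite facets_cover_complex inE.
pose ev := meval (fun i => (i \in A)%:R : k).
have evM B : ev (mon B) = (B \subset A)%:R.
  rewrite /ev /sqfree_monomial rmorph_prod /=.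
  have [BA|/subsetPn [y yB yA]] := boolP (B \subset A).
    by rewrite big1 // => i iB; rewrite mevalXU (subsetP BA).
  by rewrite (big_setD1 y) //= mevalXU (negPf yA) mul0r.
have [i Bi] : exists i, ev (g i) != 0.
  apply/existsP; apply: contraT => /existsPn g0.
  have : ev (mon A) = 0.
    rewrite Ag /ev rmorph_sum big1 // => i _.
    by rewrite /= mevalM -/(ev (g i)); move/negPn/eqP: (g0 i) => ->; rewrite mulr0.
  by rewrite evM subxx => /eqP; rewrite oner_eq0.
have [B BD giB] := gS i; move: Bi; rewrite giB evM.
have [BA _|_ ] := boolP (B \subset A); last by rewrite eqxx.
move: BD; rewrite facets_cover_complex inE => /minsetp /andP [_ /forall_inP /(_ F FD)].
by case/set0Pn => y; rewrite inE => /andP [yB yF]; exists y; last exact: (subsetP BA).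
Qed.

Lemma dual_ideal_component (D : simplicial_complex 'I_n) j p :
  sqfree_component (dual_ideal D) j p <-> cover_ideal (facets D) setT j p.
Proof.
split; apply: ideal_gen_sub => {p} p.
  move=> [A [Aj -> /dual_ideal_monomial cov]]; apply: cover_ideal_mem.
  by apply/covers_of_sizeP; split; first exact: subsetT.
move=> [Y /covers_of_sizeP [_ Yj cov] ->]; apply: ideal_gen_mem; exists Y.
by split=> //; apply/dual_ideal_monomial.
Qed.

End CoverIdeals.

Theorem corollary5p5 (k : fieldType) (n : nat) (D : simplicial_complex 'I_n)
  (hD : forest D) :
  componentwise_linear (@dual_ideal k n D).
Proof.
move=> j j0; have [P] :=
  @cover_ideal_strand k n (facets D) (facets D) setT j (forest_facets hD) (subxx _).
apply: (linear_resolution_strand j0 _ P) => p; exact: dual_ideal_component.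
Qed.
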